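(* Let $\ell\ge 1$. The set $T:=\{0\}\cup\{B_i(r,m,n): 1\le i\le \ell+1,\ r\in\mathbb{Z},\ m,n\in\mathbb{N}^{\ell}\}$ of operators on $\ell^2(\mathbb{N})^{\otimes \ell}\otimes\ell^2(\mathbb{Z})$ is an inverse semigroup of partial isometries (with operator multiplication, and with the operator adjoint as the involution $*$). Moreover, $T$ is generated (as an inverse semigroup) by $\{Z_i: 1\le i\le \ell+1\}$.
   Context: $\mathbb{N}$ is the set of non-negative integers and $\ell$ is a positive integer. An inverse semigroup is a semigroup $T$ such that for every $s\in T$ there is a unique element $s^*\in T$ with $s^*ss^*=s^*$ and $ss^*s=s$. ''Generated as an inverse semigroup'' means that every element is a finite product of the generators and their adjoints. $S$ is the left shift on $\ell^2(\mathbb{N})$ ($Se_n=e_{n-1}$ for $n\ge1$, $Se_0=0$), $t$ is the right shift on $\ell^2(\mathbb{Z})$ ($te_n=e_{n+1}$), and $p=|e_0\rangle\langle e_0|$ is the rank one projection onto $e_0$ in $\ell^2(\mathbb{N})$. Let $\mathcal{H}_\ell=\ell^2(\mathbb{N})^{\otimes\ell}\otimes\ell^2(\mathbb{Z})$ with canonical orthonormal basis $e_{m,z}$, $m\in\mathbb{N}^\ell$, $z\in\mathbb{Z}$. For $r\in\mathbb{Z}$, $m,n\in\mathbb{N}^\ell$ and $1\le k\le\ell$ let $$B_k(r,m,n)=S^{*m_1}pS^{n_1}\otimes\cdots\otimes S^{*m_{k-1}}pS^{n_{k-1}}\otimes S^{*m_k}S^{n_k}\otimes 1\otimes t^{\sum_{i=1}^k(m_i-n_i)},$$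 where $1$ is the identity on the remaining $\ell-k$ copies of $\ell^2(\mathbb{N})$ (so this does not depend on $r$), and let $$B_{\ell+1}(r,m,n)=S^{*m_1}pS^{n_1}\otimes\cdots\otimes S^{*m_\ell}pS^{n_\ell}\otimes t^{r+\sum_{i=1}^\ell(m_i-n_i)}.$$ Let $Y_{k,0}=p^{\otimes(k-1)}\otimes S^*\otimes I^{\otimes(\ell+1-k)}$ for $1\le k\le\ell$ (the last identity factor acting on $\ell^2(\mathbb{Z})$) and $Y_{\ell+1,0}=p^{\otimes\ell}\otimes t$. Let $U$ be the unitary on $\mathcal{H}_\ell$ given by $U e_{m,z}=e_{m,\,z+\sum_{i=1}^{\ell}m_i}$, and put $Z_k:=UY_{k,0}U^*$ for $1\le k\le\ell+1$. *)

(* Defs.v *)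
From HB Require Import structures.
From mathcomp Require Import all_boot all_order all_algebra.
From mathcomp Require Import complex.
From mathcomp Require Import mathcomp_extra boolp classical_sets functions.
From mathcomp Require Import cardinality fsbigop reals ereal numfun esum.
From mathcomp Require Import ring lra.

Set Implicit Arguments.
Unset Strict Implicit.
Unset Printing Implicit Defensive.
Import Order.TTheory GRing.Theory Num.Theory.
Local Open Scope classical_set_scope.
Local Open Scope ring_scope.
Local Open Scope complex_scope.

Section SquareSummable.
Variables (R : realType) (I : choiceType).
Implicit Types (f g : I -> R[i]^o).

Definition sqmod (z : R[i]) : R := complex.Re z ^+ 2 + complex.Im z ^+ 2.

Definition sqsum (f : I -> R[i]^o) : \bar R :=
  \esum_(i in [set: I]) (sqmod (f i))%:E.

Lemma sqmod_ge0 z : 0 <= sqmod z.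
Proof. by rewrite addr_ge0 // sqr_ge0. Qed.

Lemma sqmod0 : sqmod 0 = 0.
Proof. by rewrite /sqmod /= expr0n addr0. Qed.

Lemma sqmodM a z : sqmod (a * z) = sqmod a * sqmod z.
Proof. by case: a z => [a b] [c d]; rewrite /sqmod /=; ring. Qed.

Lemma sqmodD x y : sqmod (x + y) <= 2 * sqmod x + 2 * sqmod y.
Proof.
case: x y => [a b] [c d]; rewrite /sqmod /=.
have := sqr_ge0 (a - c); have := sqr_ge0 (b - d); lra.
Qed.

Lemma sqsum_ge0 f : (0 <= sqsum f)%E.
Proof. by apply: esum_ge0 => i _; rewrite lee_fin sqmod_ge0. Qed.

Lemma esumZ_lt (c : R) (a : I -> R) : 0 <= c -> (forall i, 0 <= a i) ->
  (\esum_(i in [set: I]) (c * a i)%:E <=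
    c%:E * \esum_(i in [set: I]) (a i)%:E)%E.
Proof.
move=> c0 a0; apply: ge_ereal_sup => _ [X [finX _] <-].
rewrite fsbig_finite //=; under eq_bigr do rewrite EFinM.
rewrite -ge0_sume_distrr; last by move=> i _; rewrite lee_fin.
rewrite lee_wpmul2l ?lee_fin// -fsbig_finite//.
by apply: esum_ge; exists X.
Qed.

Lemma sqsum_lin (a : R[i]) f g :
  (sqsum f < +oo)%E -> (sqsum g < +oo)%E -> (sqsum (a *: f + g)%R < +oo)%E.
Proof.
move=> ff fg.
pose h1 i := 2 * sqmod a * sqmod (f i); pose h2 i := 2 * sqmod (g i).
apply: (@le_lt_trans _ _ (\esum_(i in [set: I]) (h1 i)%:E +
                         \esum_(i in [set: I]) (h2 i)%:E)%E).
  rewrite -esumD; try by move=> i _; rewrite lee_fin !mulr_ge0 ?sqmod_ge0.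
  apply: le_esum => i _; rewrite -EFinD lee_fin /h1 /h2.
  by rewrite (le_trans (sqmodD _ _))// sqmodM mulrA.
rewrite lte_add_pinfty //.
  apply: (le_lt_trans (esumZ_lt _ _)); rewrite ?mulr_ge0 ?sqmod_ge0//.
    by move=> i; exact: sqmod_ge0.
  by rewrite lte_mul_pinfty ?lee_fin ?mulr_ge0 ?sqmod_ge0.
apply: (le_lt_trans (esumZ_lt _ _)); rewrite ?ler0n//.
  by move=> i; exact: sqmod_ge0.
by rewrite lte_mul_pinfty ?lee_fin ?ler0n.
Qed.

Definition l2_pred : {pred I -> R[i]^o} := mem [set f | (sqsum f < +oo)%E].

Lemma l2_predE f : (f \in l2_pred) = (sqsum f < +oo)%E.
Proof. by rewrite [LHS]asboolb. Qed.

Lemma sqsum0 : sqsum (0 : I -> R[i]^o) = 0%E.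
Proof. by apply: esum1 => i _; rewrite sqmod0. Qed.

Lemma l2_submod_closed : submod_closed l2_pred.
Proof.
split=> [|a f g]; rewrite !l2_predE; last exact: sqsum_lin.
by rewrite sqsum0 ltry.
Qed.

HB.instance Definition _ := GRing.isSubmodClosed.Build _ _ l2_pred
  l2_submod_closed.

Record l2 := L2 { l2_fun :> I -> R[i]^o; _ : l2_fun \in l2_pred }.

HB.instance Definition _ := [isSub of l2 for l2_fun].
HB.instance Definition _ := [Choice of l2 by <:].
HB.instance Definition _ := [SubChoice_isSubLmodule of l2 by <:].

End SquareSummable.

Section Geometry.
Variables (R : realType) (I : choiceType).
Implicit Types (x y : l2 R I).

Lemma l2P x : (sqsum x < +oo)%E.
Proof. by case: x => f /=; rewrite l2_predE. Qed.

Lemma l2_eq x y : x =1 y -> x = y.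
Proof. by move=> xy; apply: val_inj; apply/funext. Qed.

Definition norm x : R := Num.sqrt (fine (sqsum x)).

(* Sum of an absolutely summable real family. *)
Definition rsum (h : I -> R) : R :=
  fine (\esum_(i in [set: I]) (EFin \o h)^\+ i
        - \esum_(i in [set: I]) (EFin \o h)^\- i)%E.

(* Linear in the first argument, conjugate linear in the second. *)
Definition ip x y : R[i] :=
  rsum (fun i => complex.Re (x i * conjc (y i))) +i*
  rsum (fun i => complex.Im (x i * conjc (y i))).

Definition delta (i : I) : I -> R[i]^o := fun j => (j == i)%:R.

Lemma delta_l2 i : delta i \in @l2_pred R I.
Proof.
rewrite l2_predE /sqsum.
rewrite (eq_esum (b := fun j => if j \in [set i] then 1%:E else 0%E)).
  by rewrite -esum_mkcond esum_set1 ?lee_fin ?ltry.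
move=> j _; rewrite /delta; case: eqP => [->|ne].
  by rewrite mem_set // /sqmod /= expr1n expr0n addr0.
by rewrite memNset // sqmod0.
Qed.

Definition basis (i : I) : l2 R I := L2 (delta_l2 i).

Lemma norm_ge0 x : 0 <= norm x.
Proof. exact: sqrtr_ge0. Qed.

Lemma sqsumE x : sqsum x = (norm x ^+ 2)%:E.
Proof.
rewrite sqr_sqrtr; last exact/fine_ge0/sqsum_ge0.
by rewrite fineK // ge0_fin_numE ?l2P ?sqsum_ge0.
Qed.

Lemma norm_le (M : R) x y : 0 <= M ->
  (sqsum y <= (M ^+ 2)%:E * sqsum x)%E -> norm y <= M * norm x.
Proof.
move=> M0; rewrite !sqsumE -EFinM lee_fin -exprMn.
by rewrite ler_pXn2r ?nnegrE ?norm_ge0 ?mulr_ge0 ?norm_ge0.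
Qed.

Lemma sqsum_le (M : R) x y : norm y <= M * norm x ->
  (sqsum y <= (M ^+ 2)%:E * sqsum x)%E.
Proof.
move=> h; rewrite !sqsumE -EFinM lee_fin -exprMn.
by rewrite ler_pXn2r ?nnegrE ?norm_ge0 ?(le_trans (norm_ge0 y)).
Qed.

End Geometry.

Section Reindexing.
Variables (R : realType) (I : choiceType) (g g' : I -> option I).
Hypothesis gK : forall i j, g i = Some j <-> g' j = Some i.

Lemma esum_partial_inj (a a' : I -> \bar R) :
  (forall i j, g i = Some j -> a i = a' j) ->
  (forall i, g i = None -> a i = 0%E) ->
  (forall j, g' j = None -> a' j = 0%E) ->
  (\esum_(i in [set: I]) a i = \esum_(j in [set: I]) a' j)%E.
Proof.
move=> aa' a0 a'0.
pose D := [set i | isSome (g i)]; pose D' := [set j | isSome (g' j)].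
have -> : (\esum_(i in [set: I]) a i = \esum_(i in D) a i)%E.
  rewrite [RHS]esum_mkcond; apply: eq_esum => i _; case: ifPn => //.
  by rewrite notin_setE /D /=; case gi: (g i) => // _; exact: a0.
have -> : (\esum_(j in [set: I]) a' j = \esum_(j in D') a' j)%E.
  rewrite [RHS]esum_mkcond; apply: eq_esum => i _; case: ifPn => //.
  by rewrite notin_setE /D' /=; case gi: (g' i) => // _; exact: a'0.
pose G i := odflt i (g i).
rewrite (reindex_esum D D' G).
  apply: eq_esum => i; rewrite /D /G /=; case gi: (g i) => [j|] //= _.
  exact: aa'.
split.
- move=> i; rewrite /D /D' /G /=; case gi: (g i) => [j|] //= _.
  by move/gK: gi => ->.
- move=> i j; rewrite /D /G !inE /=.
  case gi: (g i) => [i'|] //=; case gj: (g j) => [j'|] //= _ _ ij.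
  by move/gK: gi; move/gK: gj; rewrite ij => -> [].
- move=> j; rewrite /D' /=; case gj: (g' j) => [i|] //= _.
  by exists i; rewrite /D /G /= ((gK _ _).2 gj).
Qed.

Lemma rsum_partial_inj (h h' : I -> R) :
  (forall i j, g i = Some j -> h i = h' j) ->
  (forall i, g i = None -> h i = 0) ->
  (forall j, g' j = None -> h' j = 0) ->
  rsum h = rsum h'.
Proof.
move=> hh' h0 h'0; rewrite /rsum.
congr (fine (_ - _)%E);
  apply: esum_partial_inj => [i j /hh' hE|i /h0 hE|i /h'0 hE];
  by rewrite ?funeposE ?funenegE /= hE ?oppr0 ?maxxx.
Qed.

End Reindexing.

Section Operators.
Variables (R : realType).

Record op (I : choiceType) := Op {
  op_fun :> l2 R I -> l2 R I;
  op_linear : linear op_fun;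
  op_bounded : exists M : R, forall x, norm (op_fun x) <= M * norm x }.

HB.instance Definition _ I := gen_eqMixin (op I).
HB.instance Definition _ I := gen_choiceMixin (op I).

Section Algebra.
Variable I : choiceType.
Implicit Types (A B C : op I) (x y : l2 R I).

Lemma op_eq A B : A =1 B -> A = B.
Proof.
case: A B => [f fl fb] [g gl gb] /= /funext fg.
by subst g; congr Op; exact: Prop_irrelevance.
Qed.

Lemma op_scale A a x : A (a *: x) = a *: A x.
Proof.
have A0 : A 0 = 0.
  have := op_linear A 1 0 0; rewrite !scale1r addr0 => h.
  by apply: (addrI (A 0)); rewrite addr0 -h.
by rewrite -[a *: x]addr0 op_linear A0 addr0.
Qed.

Program Definition op0 : op I := @Op I (fun=> 0) _ _.
Next Obligation. by move=> a x y /=; rewrite scaler0 addr0. Qed.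
Next Obligation.
by exists 0 => x; rewrite mul0r /norm /= sqsum0 sqrtr0.
Qed.

Program Definition op1 : op I := @Op I id _ _.
Next Obligation. by []. Qed.
Next Obligation. by exists 1 => x; rewrite mul1r. Qed.

Program Definition op_mul A B : op I := @Op I (A \o B) _ _.
Next Obligation. by move=> A B a x y /=; rewrite !op_linear. Qed.
Next Obligation.
move=> A B; have [M hM] := op_bounded A; have [N hN] := op_bounded B.
exists (`|M| * N) => x /=; rewrite (le_trans (hM _))//.
rewrite (le_trans (ler_wpM2r (norm_ge0 _) (ler_norm M)))//.
by rewrite -mulrA ler_wpM2l.
Qed.

Fixpoint op_exp A (n : nat) : op I :=
  if n is n'.+1 then op_mul A (op_exp A n') else op1.

Definition is_adjoint A B := forall x y, ip (A x) y = ip x (B y).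

(* The operator B with <A x, y> = <x, B y>; the default value op0 plays no
   role, as bounded operators on l2 have adjoints. *)
Definition adj A : op I := xget op0 [set B | is_adjoint A B].

(* Isometric on the orthogonal complement of the kernel. *)
Definition partial_isometry A :=
  forall x, (forall y, A y = 0 -> ip x y = 0) -> norm (A x) = norm x.

(* The integer powers of a unitary operator. *)
Definition unitary_exp A (z : int) : op I :=
  match z with Posz n => op_exp A n | Negz n => op_exp (adj A) n.+1 end.

End Algebra.

Section Pullback.
Variables (I : choiceType) (g : I -> option I).
Hypothesis g_inj : forall i j k, g i = Some k -> g j = Some k -> i = j.

Definition pull (f : I -> R[i]^o) : I -> R[i]^o :=
  fun i => if g i is Some j then f j else 0.

Lemma sqsum_pull f : (sqsum (pull f) <= sqsum f)%E.
Proof.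
rewrite /sqsum.
have [i0|noI] := pselect (exists i : I, True); last first.
  by rewrite esum1 ?sqsum_ge0 // => i _; case: noI; exists i.
case: i0 => i0 _; pose D := [set i | isSome (g i)].
pose G i := odflt i0 (g i).
rewrite (eq_esum (b := fun i => if i \in D then (sqmod (f (G i)))%:E else 0%E)).
  rewrite -esum_mkcond -(esum_image D G (fun j => (sqmod (f j))%:E)).
    rewrite [leLHS]esum_mkcond; apply: le_esum => i _.
    by case: ifP => // _; rewrite lee_fin sqmod_ge0.
  move=> i j; rewrite /D /G !inE /=.
  case: (g i) (@g_inj i j) => //= a ha; case gj: (g j) => [b|] //= _ _ ab.
  by apply: (ha a) => //; rewrite gj ab.
move=> i _; rewrite /pull /G /D.
case gi: (g i) => [j|] /=; first by rewrite mem_set //= gi.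
by rewrite memNset /= ?gi ?sqmod0.
Qed.

Lemma pull_l2 (x : l2 R I) : pull x \in @l2_pred R I.
Proof. by rewrite l2_predE (le_lt_trans (sqsum_pull x)) ?l2P. Qed.

Program Definition pullback : op I := @Op I (fun x => L2 (pull_l2 x)) _ _.
Next Obligation.
move=> a x y; apply: l2_eq => i.
change (pull (a *: x + y) i = a * pull x i + pull y i).
by rewrite /pull; case: (g i) => [//|]; rewrite mulr0 addr0.
Qed.
Next Obligation.
exists 1 => x; apply: norm_le => //=.
by rewrite expr1n mul1e sqsum_pull.
Qed.

End Pullback.

(* A coordinate with values in K of an index set I: [get i] is the coordinate
   of i, and [put i k] is i with this coordinate replaced by k. *)
Record coordinate (I K : Type) := Coordinate {
  get : I -> K;
  put : I -> K -> I;
  get_put : forall i k, get (put i k) = k;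
  put_get : forall i, put i (get i) = i;
  put_put : forall i k k', put (put i k) k' = put i k' }.

Section Adjoint.
Variable I : choiceType.
Implicit Types (x y : l2 R I).

Lemma rsum1 (h : I -> R) k : (forall i, i != k -> h i = 0) -> rsum h = h k.
Proof.
move=> h0; rewrite /rsum.
have E (a : I -> \bar R) : (0 <= a k)%E -> (forall i, i != k -> a i = 0%E) ->
    (\esum_(i in [set: I]) a i = a k)%E.
  move=> ak a0; rewrite -[RHS](esum_set1 ak) [RHS]esum_mkcond.
  by apply: eq_esum => i _; case: ifPn => //; rewrite notin_setE => /eqP/a0.
rewrite !E ?funepos_ge0 ?funeneg_ge0 //.
- by rewrite -[RHS]/(fine ((EFin \o h) k)) [in RHS](funeposneg (EFin \o h)).
- by move=> i /h0 hi; rewrite funenegE /= hi oppr0 maxxx.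
- by move=> i /h0 hi; rewrite funeposE /= hi maxxx.
Qed.

Lemma ip_basis i y : ip (basis R i) y = conjc (y i).
Proof.
have b0 j : j != i -> basis R i j = 0 by rewrite /= /delta => /negPf ->.
have b1 : basis R i i = 1 by rewrite /= /delta eqxx.
rewrite /ip (rsum1 (k := i)); last by move=> j /b0 ->; rewrite mul0r.
rewrite (rsum1 (k := i)); last by move=> j /b0 ->; rewrite mul0r.
by rewrite b1 mul1r; case: (y i).
Qed.

Lemma adjoint_unique (A B C : op I) : is_adjoint A B -> is_adjoint A C -> B = C.
Proof.
move=> AB AC; apply: op_eq => y; apply: l2_eq => i.
apply: (can_inj (@conjcK R)).
by rewrite -[LHS]ip_basis -[RHS]ip_basis -AB -AC.
Qed.

Lemma adjE (A B : op I) : is_adjoint A B -> adj A = B.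
Proof.
move=> AB; apply: (adjoint_unique _ AB).
exact: (xgetI (op0 I) (P := [set B | is_adjoint A B]) AB).
Qed.

Lemma adj_pullback (g g' : I -> option I) gI g'I :
  (forall i j, g i = Some j <-> g' j = Some i) ->
  adj (@pullback I g gI) = @pullback I g' g'I.
Proof.
move=> gK; apply: adjE => x y; rewrite /ip /= /pull.
congr (_ +i* _); apply: (rsum_partial_inj gK) => [i j gi|i ->|j ->];
  rewrite ?mul0r ?conjc0 ?mulr0 //.
  by rewrite gi ((gK _ _).1 gi).
by rewrite gi ((gK _ _).1 gi).
Qed.

End Adjoint.

Section Ampliation.
Variables (I K : choiceType) (c : coordinate I K) (A : op K).

Definition slice (f : I -> R[i]^o) (i : I) : K -> R[i]^o :=
  fun k => f (put c i k).

Lemma slice_l2 (x : l2 R I) i : slice x i \in @l2_pred R K.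
Proof.
rewrite l2_predE; apply: le_lt_trans (l2P x).
rewrite /sqsum /slice -(esum_image setT (put c i) (fun j => (sqmod (x j))%:E)).
  rewrite [leLHS]esum_mkcond; apply: le_esum => j _.
  by case: ifP => // _; rewrite lee_fin sqmod_ge0.
by move=> k k' _ _ /(congr1 (get c)); rewrite !get_put.
Qed.

Definition sliceop (x : l2 R I) : I -> R[i]^o :=
  fun i => A (L2 (slice_l2 x i)) (get c i).

Lemma esum_slices (i0 : I) (a : I -> \bar R) : (forall i, (0 <= a i)%E) ->
  (\esum_(i in [set: I]) a i =
   \esum_(i in [set i | get c i = get c i0])
     \esum_(k in [set: K]) a (put c i k))%E.
Proof.
move=> a0; rewrite esum_esum //.
apply: (reindex_esum _ _ (fun ik : I * K => put c ik.1 ik.2)); split => //.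
  move=> [i k] [j k']; rewrite !inE /= => -[gi _] [gj _] ij.
  have kk' : k = k' by rewrite -(get_put c i k) ij get_put.
  congr (_, _) => //; rewrite -(put_get c i) -(put_get c j) gi gj.
  by rewrite -(put_put c i k) ij put_put.
move=> i _; exists (put c i (get c i0), get c i) => /=.
  by split=> //; rewrite get_put.
by rewrite put_put put_get.
Qed.

Lemma sqsum_sliceop (M : R) (x : l2 R I) :
  (forall y, norm (A y) <= M * norm y) ->
  (sqsum (sliceop x) <= (M ^+ 2)%:E * sqsum x)%E.
Proof.
move=> AM.
have [[i0 _]|noI] := pselect (exists i : I, True); last first.
  rewrite {1}/sqsum esum1 ?mule_ge0 ?sqsum_ge0 ?lee_fin ?sqr_ge0 //.
  by move=> i _; case: noI; exists i.
rewrite {1 2}/sqsum !(esum_slices i0); try by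
  move=> i; rewrite lee_fin sqmod_ge0.
apply: (@le_trans _ _ (\esum_(i in [set i | get c i = get c i0])
   ((M ^+ 2)%:E * sqsum (slice x i)))%E).
  apply: le_esum => i _.
  rewrite (eq_esum (b := fun k => (sqmod (A (L2 (slice_l2 x i)) k))%:E)).
    exact: (sqsum_le (AM (L2 (slice_l2 x i)))).
  move=> k _; rewrite /sliceop get_put; do 3!congr (_ _).
  congr (A _ _); apply: l2_eq => k' /=; rewrite /slice.
  by rewrite put_put.
apply: ge_ereal_sup => _ [X [finX XI] <-].
rewrite fsbig_finite //= -ge0_sume_distrr; last by move=> i _; exact: sqsum_ge0.
rewrite lee_wpmul2l ?lee_fin ?sqr_ge0 // -fsbig_finite //.
by apply: esum_ge; exists X.
Qed.

Lemma sliceop_l2 (x : l2 R I) : sliceop x \in @l2_pred R I.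
Proof.
have [M AM] := op_bounded A.
rewrite l2_predE (le_lt_trans (sqsum_sliceop x AM)) //.
by rewrite sqsumE -EFinM ltry.
Qed.

(* The operator 1 (x) ... (x) A (x) ... (x) 1 acting as A on the coordinate c:
   it applies A to x viewed as a function of this coordinate only. *)
Program Definition ampliation : op I := @Op I (fun x => L2 (sliceop_l2 x)) _ _.
Next Obligation.
move=> a x y; apply: l2_eq => i.
change (sliceop (a *: x + y) i = a * sliceop x i + sliceop y i).
rewrite /sliceop; set sx := L2 (slice_l2 x i); set sy := L2 (slice_l2 y i).
have -> : L2 (slice_l2 (a *: x + y) i) = a *: sx + sy by exact: l2_eq.
by rewrite op_linear.
Qed.
Next Obligation.
have [M AM] := op_bounded A; exists `|M| => x; apply: norm_le => //.
by rewrite real_normK ?num_real //; exact: sqsum_sliceop.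
Qed.

End Ampliation.

End Operators.

Arguments op0 {R I}.
Arguments op1 {R I}.
Notation "A ** B" := (op_mul A B) (at level 40, left associativity).
Notation "A ^** n" := (op_exp A n) (at level 30, right associativity).

(* The index set of the orthonormal basis e_(m,z) of the Hilbert tensor product
   of l copies of l2(N) and one copy of l2(Z), which is identified with l2 of
   this index set. *)
Definition idx (l : nat) : choiceType := ({ffun 'I_l -> nat} * int)%type.

Section Tensor.
Variables (R : realType) (l : nat).

Program Definition coordN (i : 'I_l) : coordinate (idx l) nat :=
  @Coordinate (idx l) nat (fun mz => mz.1 i)
    (fun mz k => ([ffun j => if j == i then k else mz.1 j], mz.2)) _ _ _.
Next Obligation. by move=> i mz k /=; rewrite ffunE eqxx. Qed.
Next Obligation.
move=> i [m z] /=; congr (_, _); apply/ffunP => j; rewrite ffunE.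
by case: eqP => [->|].
Qed.
Next Obligation.
move=> i [m z] k k' /=; congr (_, _); apply/ffunP => j; rewrite !ffunE.
by case: eqP.
Qed.

Program Definition coordZ : coordinate (idx l) int :=
  @Coordinate (idx l) int snd (fun mz k => (mz.1, k)) _ _ _.
Next Obligation. by []. Qed.
Next Obligation. by case. Qed.
Next Obligation. by []. Qed.

Implicit Types (A : 'I_l -> op R nat) (B : op R int).

(* A_1 (x) ... (x) A_l (x) B; tensorE below shows that it maps
   x_1 (x) ... (x) x_l (x) y to A_1 x_1 (x) ... (x) A_l x_l (x) B y. *)
Definition tensor A B : op R (idx l) :=
  (\big[@op_mul R (idx l)/op1]_(i < l) ampliation (coordN i) (A i))
    ** ampliation coordZ B.

Definition elementary (x : 'I_l -> l2 R nat) (y : l2 R int) : idx l -> R[i]^o :=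
  fun mz => (\prod_(i < l) x i (mz.1 i)) * y mz.2.

Lemma ampliationN_elementary (i : 'I_l) (C : op R nat) x y (v : l2 R (idx l)) :
  v =1 elementary x y ->
  ampliation (coordN i) C v =1
  elementary (fun j => if j == i then C (x j) else x j) y.
Proof.
move=> vE [m z].
change (C (L2 (slice_l2 (coordN i) v (m, z))) (m i) =
  elementary (fun j => if j == i then C (x j) else x j) y (m, z)).
pose a : R[i] := (\prod_(j < l | j != i) x j (m j)) * y z.
have -> : L2 (slice_l2 (coordN i) v (m, z)) = a *: x i.
  apply: l2_eq => k.
  change (v ([ffun j => if j == i then k else m j], z) = a * x i k).
  rewrite vE /elementary /= (bigD1 i) //= ffunE eqxx /a.
  under eq_bigr => j ji do rewrite ffunE (negPf ji).
  by rewrite [RHS]mulrC mulrA.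
rewrite op_scale.
change (a * C (x i) (m i) =
  elementary (fun j => if j == i then C (x j) else x j) y (m, z)).
rewrite /elementary /= [in RHS](bigD1 i) //= eqxx /a.
rewrite [in RHS](eq_bigr (fun j => x j (m j))).
  by rewrite [LHS]mulrC mulrA.
by move=> j /negPf ->.
Qed.

Lemma ampliationZ_elementary (C : op R int) x y (v : l2 R (idx l)) :
  v =1 elementary x y ->
  ampliation coordZ C v =1 elementary x (C y).
Proof.
move=> vE [m z].
change (C (L2 (slice_l2 coordZ v (m, z))) z = elementary x (C y) (m, z)).
have -> : L2 (slice_l2 coordZ v (m, z)) = (\prod_(j < l) x j (m j)) *: y.
  by apply: l2_eq => k; exact: vE (m, k).
by rewrite op_scale.
Qed.

Lemma tensorE A B x y (v : l2 R (idx l)) : v =1 elementary x y ->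
  tensor A B v =1 elementary (fun i => A i (x i)) (B y).
Proof.
move=> /(ampliationZ_elementary B) vE.
pose w : l2 R (idx l) := ampliation coordZ B v.
change ((\big[@op_mul R (idx l)/op1]_(i < l) ampliation (coordN i) (A i)) w =1
  elementary (fun i => A i (x i)) (B y)).
have {}vE : w =1 elementary x (B y) := vE.
move: w (B y) vE => {}v {}y vE.
have H (s : seq 'I_l) : uniq s ->
  (\big[@op_mul R (idx l)/op1]_(i <- s) ampliation (coordN i) (A i)) v =1
  elementary (fun i => if i \in s then A i (x i) else x i) y.
  elim: s => [_|i s IH /= /andP[si us]]; first by rewrite big_nil.
  rewrite big_cons => mz.
  rewrite [LHS](ampliationN_elementary _ _ (IH us)) /elementary.
  congr (_ * _); apply: eq_bigr => j _; rewrite inE.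
  by case: eqP => //= ->; rewrite (negPf si).
move=> mz; rewrite (H _ (index_enum_uniq _)) /elementary.
by congr (_ * _); apply: eq_bigr => j _; rewrite mem_index_enum.
Qed.

End Tensor.

Section Model.
Variable R : realType.

Program Definition shift : op R nat := pullback R (g := fun n => Some n.+1) _.
Next Obligation. by move=> i j k /= [<-] [->]. Qed.

Lemma shift_basis n : shift (basis R n) = if n is n'.+1 then basis R n' else 0.
Proof. by apply: l2_eq => i; case: n => [|n] //=; rewrite /delta eqSS. Qed.

Program Definition proj0 : op R nat :=
  pullback R (g := fun n => if n == 0%N then Some 0%N else None) _.
Next Obligation. by move=> [|i] [|j]. Qed.

Lemma proj0E x : proj0 x = x 0%N *: basis R 0%N.
Proof.
apply: l2_eq => i; change (pull (fun n => if n == 0%N then Some 0%N else None) x i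
  = x 0%N * delta R 0%N i).
by rewrite /pull /delta; case: i => [|i] /=; rewrite ?mulr1 ?mulr0.
Qed.

Program Definition bishift : op R int :=
  pullback R (g := fun z => Some (z - 1)) _.
Next Obligation. by move=> i j k /= [<-] [/addIr ->]. Qed.

Lemma bishift_basis z : bishift (basis R z) = basis R (z + 1).
Proof. by apply: l2_eq => i; rewrite /= /pull /= /delta subr_eq. Qed.

Section Rank.
Variable l : nat.

Definition total (m : {ffun 'I_l -> nat}) : int := \sum_(i < l) (m i)%:Z.

Program Definition unitU : op R (idx l) :=
  pullback R (g := fun mz : idx l => Some (mz.1, mz.2 - total mz.1)) _.
Next Obligation. by move=> [m z] [m' z'] k /= [<-] [-> /addIr ->]. Qed.

Lemma unitU_basis m z :
  unitU (basis R ((m, z) : idx l)) = basis R ((m, z + total m) : idx l).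
Proof.
apply: l2_eq => -[m' z']; rewrite /= /pull /= /delta; congr (_%:R).
by rewrite !xpair_eqE /=; case: eqP => //= ->; rewrite subr_eq.
Qed.

(* The index k of opB, opY and opZ ranges over 1, ..., l + 1; the copy of l2(N)
   indexed by i : 'I_l is the tensor factor number i + 1. *)
Definition opB (k : nat) (r : int) (m n : {ffun 'I_l -> nat}) : op R (idx l) :=
  tensor
    (fun i : 'I_l =>
       if (i.+1 < k)%N then adj shift ^** m i ** proj0 ** shift ^** n i
       else if i.+1 == k then adj shift ^** m i ** shift ^** n i
       else op1)
    (unitary_exp bishift
       ((if k == l.+1 then r else 0) +
        \sum_(i < l | (i.+1 <= k)%N) ((m i)%:Z - (n i)%:Z))).

Definition opY (k : nat) : op R (idx l) :=
  tensor
    (fun i : 'I_l =>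
       if (i.+1 < k)%N then proj0 else if i.+1 == k then adj shift else op1)
    (if k == l.+1 then bishift else op1).

Definition opZ (k : nat) : op R (idx l) := unitU ** opY k ** adj unitU.

Definition opT : set (op R (idx l)) :=
  [set A | A = op0 \/
    exists (k : nat) (r : int) (m n : {ffun 'I_l -> nat}),
      (1 <= k <= l.+1)%N /\ A = opB k r m n].

End Rank.
End Model.

Arguments opT : clear implicits.

Section InverseSemigroup.
Variables (G : Type) (mul : G -> G -> G) (star : G -> G).

(* The subset M of G is an inverse semigroup under mul, whose involution is the
   restriction of star. *)
Definition inverse_semigroup (M : set G) : Prop :=
  [/\ forall a b, M a -> M b -> M (mul a b),
      forall a b c, M a -> M b -> M c -> mul a (mul b c) = mul (mul a b) c,
      forall a, M a ->
        [/\ M (star a), mul (mul (star a) a) (star a) = star a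
          & mul (mul a (star a)) a = a]
    & forall a b, M a -> M b ->
        mul (mul b a) b = b -> mul (mul a b) a = a -> b = star a].

Inductive generated (X : set G) : set G :=
| generated_in a : X a -> generated X a
| generated_star a : X a -> generated X (star a)
| generated_mul a b :
    generated X a -> generated X b -> generated X (mul a b).

End InverseSemigroup.

(* Main.v *)
Require Import Defs.
From HB Require Import structures.
From mathcomp Require Import all_boot all_order all_algebra.
From mathcomp Require Import complex.
From mathcomp Require Import mathcomp_extra boolp classical_sets functions.
From mathcomp Require Import cardinality fsbigop reals ereal numfun esum.
From mathcomp Require Import zify.

Set Implicit Arguments.
Unset Strict Implicit.
Unset Printing Implicit Defensive.
Import Order.TTheory GRing.Theory Num.Theory.
Local Open Scope classical_set_scope.
Local Open Scope ring_scope.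

(** All operators in sight permute the orthonormal basis partially: each of them
is the 0-1 matrix of the graph P of a partial bijection of the index set of the
basis. For such operators the product is relational composition, the adjoint is
the converse relation, and the graph is determined by the operator. Hence they
are partial isometries, they satisfy A A* A = A, and an inverse of A in the
semigroup sense must have the converse graph, that is, must be A*. The first
two claims are thereby reduced to showing that T is closed under products and
adjoints.

The graph of a tensor product is the product of the graphs of its factors, and
the factors occurring in B_k(r,m,n) are matrix units S*^m p S^n, elements
S*^m S^n of the bicyclic monoid, and identities. The exponent of the bilateral
shift in B_k is exactly the change of the total degree m_1 + ... + m_l (plus r
if k = l+1), so B_k(r,m,n) relates (a,z) to (b,w) iff the coordinates of a and b
are related by the factors and z - |a| = w - |b| + r (without r if k <= l).
This is the effect of conjugation by U: in the coordinate z - |a|, the operator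
B_k is a translation by r or the identity. In particular Z_k is B_k(1,e_k,0),
where e_k is the k-th unit vector, and 0 if k = l+1.

The product B_k(r,m,n) B_j(r',m',n') with k <= j is computed factor by factor
([cell_mul]): if n_i = m'_i for i < k and n_k <= m'_k, it is an explicit B_j
([opB_mul]). If instead n_k > m'_k while k = j, and n_i = m'_i for i < k, the
adjoint of the product is of this form; in all other cases some pair of
corresponding factors has product zero. The case k > j is the adjoint of the
case k < j.

For the generation, the same product rule gives B_k(r,0,0) from Z_k* Z_k and
powers of Z_k or Z_k*, then B_k(r,m,0) by multiplying from the left by Z_j with
j the first index where m is nonzero ([generated_left]), and finally
B_k(r,m,n) = B_k(r,m,0) B_k(0,n,0)*. The zero operator is Z_1* Z_2. *)

(** * Operators given by partial bijections of the basis *)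

Section PartialBijections.
Variables (R : realType) (I : choiceType).
Implicit Types (A B : op R I) (P Q : I -> I -> Prop) (g : I -> option I).

(** Rows are related to columns: A maps the basis vector e_j to e_i when P i j.
Relations are used rather than partial functions because adjoints and tensor
products are symmetric operations on them. *)
Definition has_graph A P := exists g
  (gI : forall i j k, g i = Some k -> g j = Some k -> i = j),
  A = pullback R gI /\ forall i j, g i = Some j <-> P i j.

Lemma has_graph_pullback g
    (gI : forall i j k, g i = Some k -> g j = Some k -> i = j) P :
  (forall i j, g i = Some j <-> P i j) -> has_graph (pullback R gI) P.
Proof. by move=> gP; exists g, gI. Qed.

Lemma has_graph_ext A P Q :
  has_graph A P -> (forall i j, P i j <-> Q i j) -> has_graph A Q.
Proof.
by move=> [g [gI [-> gP]]] PQ; exists g, gI; split=> // i j; rewrite gP.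
Qed.

Lemma has_graph_fun A P i j k : has_graph A P -> P i j -> P i k -> j = k.
Proof. by move=> [g [_ [_ gP]]] /gP ij /gP; rewrite ij => -[]. Qed.

Lemma has_graph_inj A P i j k : has_graph A P -> P i k -> P j k -> i = j.
Proof. by move=> [g [gI [_ gP]]] /gP ik /gP jk; exact: gI ik jk. Qed.

Lemma has_graph_in A P x i j : has_graph A P -> P i j -> A x i = x j.
Proof. by move=> [g [gI [-> gP]]] /gP gi; rewrite /= /pull gi. Qed.

Lemma has_graph_out A P x i : has_graph A P -> (forall j, ~ P i j) -> A x i = 0.
Proof.
move=> [g [gI [-> gP]]] Pi; rewrite /= /pull.
by case gi: (g i) => [j|] //; case: (Pi j); exact/gP.
Qed.

Lemma has_graph_eq A B P : has_graph A P -> has_graph B P -> A = B.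
Proof.
move=> AP BP; apply: op_eq => x; apply: l2_eq => i.
have [[j Pij]|Pi] := pselect (exists j, P i j).
  by rewrite (has_graph_in _ AP Pij) (has_graph_in _ BP Pij).
by rewrite (has_graph_out _ AP) ?(has_graph_out _ BP) // => j Pij;
  apply: Pi; exists j.
Qed.

(** The graph is read off the matrix entries, so it is determined by A. *)
Lemma has_graph_entry A P i j :
  has_graph A P -> P i j <-> A (Defs.basis R j) i = 1.
Proof.
move=> AP; split=> [Pij|].
  by rewrite (has_graph_in _ AP Pij) /= /delta eqxx.
have [[k Pik]|Pi] := pselect (exists k, P i k).
  rewrite (has_graph_in _ AP Pik) /= /delta.
  case: eqP => [<- //|_] /eqP.
  by rewrite eq_sym oner_eq0.
rewrite (has_graph_out _ AP) => [/eqP|k Pik]; last by apply: Pi; exists k.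
by rewrite eq_sym oner_eq0.
Qed.

Lemma has_graph_unique A P Q :
  has_graph A P -> has_graph A Q -> forall i j, P i j <-> Q i j.
Proof.
by move=> AP AQ i j; rewrite (has_graph_entry i j AP) (has_graph_entry i j AQ).
Qed.

Lemma has_graph0 : has_graph (op0 : op R I) (fun _ _ : I => False).
Proof.
have gI : forall i j k : I,
  (None : option I) = Some k -> (None : option I) = Some k -> i = j by [].
by exists (fun=> None), gI; split=> //; apply: op_eq => x; exact: l2_eq.
Qed.

Lemma has_graph1 : has_graph (op1 : op R I) (fun i j : I => i = j).
Proof.
have gI : forall i j k : I, Some i = Some k -> Some j = Some k -> i = j.
  by move=> i j k [->] [->].
exists Some, gI; split; first by apply: op_eq => x; exact: l2_eq.
by move=> i j; split=> [[]|->].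
Qed.

Lemma has_graph_mul A B P Q : has_graph A P -> has_graph B Q ->
  has_graph (A ** B) (fun i k => exists2 j, P i j & Q j k).
Proof.
move=> [g [gI [-> gP]]] [h [hI [-> hQ]]].
have ghI i j k : obind h (g i) = Some k -> obind h (g j) = Some k -> i = j.
  case gi: (g i) => [a|] //=; case gj: (g j) => [b|] //= ha hb.
  by apply: (gI _ _ a gi); rewrite gj (hI _ _ _ ha hb).
exists (fun i => obind h (g i)), ghI; split.
  apply: op_eq => x; apply: l2_eq => i; rewrite /= /pull /=.
  by case: (g i).
move=> i k; split=> [|[j /gP -> /hQ //]].
by case gi: (g i) => [j|] //= /hQ jk; exists j => //; exact/gP.
Qed.

Lemma partial_inverse g :
  (forall i j k, g i = Some k -> g j = Some k -> i = j) ->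
  exists g', forall i j, g i = Some j <-> g' j = Some i.
Proof.
move=> gI; pose g' j := if pselect (exists i, g i = Some j) is left e
  then Some (projT1 (cid e)) else None.
exists g' => i j; rewrite /g'; case: pselect => [e|ne]; last first.
  by split=> // gi; case: ne; exists i.
case: cid => i' gi' /=; split=> [gi|[<-] //].
by rewrite (gI _ _ _ gi gi').
Qed.

Lemma has_graph_adj A P : has_graph A P -> has_graph (adj A) (fun i j => P j i).
Proof.
move=> [g [gI [-> gP]]]; have [g' gK] := partial_inverse gI.
have g'I i j k : g' i = Some k -> g' j = Some k -> i = j.
  by move=> /gK ki /gK; rewrite ki => -[].
exists g', g'I; split; first exact: adj_pullback.
by move=> i j; rewrite -gK gP.
Qed.

(** Taking the converse of a relation is involutive; for these operators no
existence theorem for adjoints of bounded operators is involved. *)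
Lemma adjK A P : has_graph A P -> adj (adj A) = A.
Proof. by move=> AP; apply: has_graph_eq (AP); do 2!apply: has_graph_adj. Qed.

Lemma adj_mul A B P Q : has_graph A P -> has_graph B Q ->
  adj (A ** B) = adj B ** adj A.
Proof.
move=> AP BQ; apply: has_graph_eq (has_graph_adj (has_graph_mul AP BQ)) _.
apply: has_graph_ext (has_graph_mul (has_graph_adj BQ) (has_graph_adj AP)) _.
by move=> i j; split=> -[k]; exists k.
Qed.

Lemma has_graph_regular A P : has_graph A P -> A ** adj A ** A = A.
Proof.
move=> AP; apply: has_graph_eq (AP).
apply: has_graph_ext
  (has_graph_mul (has_graph_mul AP (has_graph_adj AP)) AP) _ => i j; split.
  by move=> [k [h ih kh] kj]; rewrite (has_graph_inj AP ih kh).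
by move=> ij; exists i => //; exists j.
Qed.

(** If PQP = P and QPQ = Q for partial bijections, an arrow i -> j of P factors
as i -> a -> b -> j through P, Q, P; injectivity and functionality of P force
a = j and b = i, so Q contains the converse arrow. The same argument with P and
Q exchanged gives the other inclusion. *)
Lemma has_graph_inverse A B P Q : has_graph A P -> has_graph B Q ->
  B ** A ** B = B -> A ** B ** A = A -> B = adj A.
Proof.
move=> AP BQ BAB ABA.
apply: has_graph_eq (BQ) _.
apply: has_graph_ext (has_graph_adj AP) _ => j i.
have := has_graph_mul (has_graph_mul AP BQ) AP; rewrite ABA => PQP.
have := has_graph_mul (has_graph_mul BQ AP) BQ; rewrite BAB => QPQ.
split=> [ij|ji].
  have /(has_graph_unique AP PQP) [b [a ia ab] bj] := ij.
  by rewrite (has_graph_fun AP ij ia) (has_graph_inj AP ij bj).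
have /(has_graph_unique BQ QPQ) [b [a ja ab] bi] := ji.
by rewrite (has_graph_fun BQ ji ja) (has_graph_inj BQ ji bi).
Qed.

Lemma ip_basisr (x : l2 R I) j : ip x (Defs.basis R j) = x j.
Proof.
have b0 i : i != j -> Defs.basis R j i = 0 by rewrite /= /delta => /negPf ->.
have b1 : Defs.basis R j j = 1 by rewrite /= /delta eqxx.
rewrite /ip !(rsum1 (k := j)); try by move=> i /b0 ->; rewrite conjc0 mulr0.
by rewrite b1 conjc1 mulr1; case: (x j).
Qed.

(** A vector orthogonal to the kernel vanishes outside the range of the partial
bijection, because the corresponding basis vectors are in the kernel; on the
range, A only reindexes the coordinates. *)
Lemma has_graph_partial_isometry A P : has_graph A P -> partial_isometry A.
Proof.
move=> AP; move: (AP) => [g [gI [AE gP]]] x xker.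
have [g' gK] := partial_inverse gI.
rewrite /norm /sqsum; congr (Num.sqrt (fine _)).
apply: (esum_partial_inj gK) => [i j /gP ij|i gi|j g'j].
- by rewrite (has_graph_in _ AP ij).
- rewrite (has_graph_out _ AP) ?sqmod0 // => j /gP.
  by rewrite gi.
- rewrite -(ip_basisr x j) xker ?sqmod0 //; apply: l2_eq => i.
  have [[k ik]|Pi] := pselect (exists k, P i k); last first.
    by rewrite (has_graph_out _ AP) // => k ik; apply: Pi; exists k.
  rewrite (has_graph_in _ AP ik) /= /delta; case: eqP => // kj.
  by move: ik; rewrite kj => /gP /gK; rewrite g'j.
Qed.

End PartialBijections.

(** * Graphs of tensor products *)

Lemma has_graph_ampliation (R : realType) (I K : choiceType)
    (c : coordinate I K) (A : op R K) (P : K -> K -> Prop) :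
  has_graph A P ->
  has_graph (ampliation c A)
    (fun i j => P (Defs.get c i) (Defs.get c j) /\ j = put c i (Defs.get c j)).
Proof.
move=> [g [gI [-> gP]]]; pose h i := omap (put c i) (g (Defs.get c i)).
have hI i j k : h i = Some k -> h j = Some k -> i = j.
  rewrite /h; case gi: (g (Defs.get c i)) => [a|] //= [<-].
  case gj: (g (Defs.get c j)) => [b|] //= [bE].
  have ab : b = a by have /(congr1 (Defs.get c)) := bE; rewrite !get_put.
  subst b; rewrite -(put_get c i) -(put_get c j) -(gI _ _ _ gi gj).
  by rewrite -(put_put c i a) -(put_put c j a) bE.
exists h, hI; split.
  apply: op_eq => x; apply: l2_eq => i.
  by rewrite /= /sliceop /= /pull /h /slice /=; case: (g (Defs.get c i)).
move=> i j; rewrite /h; split.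
  case gi: (g (Defs.get c i)) => [a|] //= [<-].
  by rewrite get_put; split=> //; exact/gP.
by move=> [/gP -> {2}->].
Qed.

Section TensorGraph.
Variables (R : realType) (l : nat).

(** The tensor product is a product of ampliations, each of which changes its
own coordinate only, so the factors of the composite graph do not interact. *)
Lemma has_graph_tensor (A : 'I_l -> op R nat) (B : op R int)
    (P : 'I_l -> nat -> nat -> Prop) (Q : int -> int -> Prop) :
  (forall i, has_graph (A i) (P i)) -> has_graph B Q ->
  has_graph (tensor A B)
    (fun u v : idx l => (forall i, P i (u.1 i) (v.1 i)) /\ Q u.2 v.2).
Proof.
move=> AP BQ.
have H (s : seq 'I_l) : uniq s -> has_graph
    (\big[@op_mul R (idx l)/op1]_(i <- s) ampliation (coordN i) (A i))
    (fun u v : idx l => (forall i, if i \in s then P i (u.1 i) (v.1 i)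
       else u.1 i = v.1 i) /\ u.2 = v.2).
  elim: s => [_|i s IH /= /andP[si us]].
    rewrite big_nil; apply: has_graph_ext (has_graph1 _ _) _ => -[a z] [b w] /=.
    by split=> [[-> ->] //|[ab ->]]; congr (_, _); apply/ffunP.
  rewrite big_cons.
  apply: has_graph_ext
    (has_graph_mul (has_graph_ampliation (coordN i) (AP i)) (IH us)) _.
  move=> [a z] [b w] /=; split.
    move=> [[c y] /= [aci [cE ->]] [cb <-]]; split=> // j; rewrite inE.
    have := cb j; case: eqP => [->|ji] /=; first by rewrite (negPf si) => <-.
    by rewrite {1 2}cE !ffunE; case: eqP ji.
  move=> [ab <-]; exists ([ffun j => if j == i then b i else a j], z) => /=.
    rewrite ffunE eqxx; split; last by [].
    by have := ab i; rewrite inE eqxx.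
  split=> // j; have := ab j; rewrite inE ffunE.
  by case: eqP => [->|] //=; rewrite (negPf si).
apply: has_graph_ext (has_graph_mul (H _ (index_enum_uniq _))
  (has_graph_ampliation (coordZ l) BQ)) _ => -[a z] [b w] /=; split.
  move=> [[c y] /= [ac ->] [yw [->]]]; split=> // i.
  by have := ac i; rewrite mem_index_enum.
move=> [ab zw]; exists (b, z) => //=; split=> // i.
by rewrite mem_index_enum.
Qed.

End TensorGraph.

(** * Graphs of the shifts and of the tensor factors *)

Section ShiftGraphs.
Variable R : realType.

Lemma has_graph_shift_exp n :
  has_graph (shift R ^** n) (fun a b => b = (a + n)%N).
Proof.
have S1 : has_graph (shift R) (fun a b => b = a.+1).
  by apply: has_graph_pullback => i j; split=> [[]|->].
elim: n => [|n IH] /=.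
  by apply: has_graph_ext (has_graph1 _ _) _ => a b; rewrite addn0; split.
apply: has_graph_ext (has_graph_mul S1 IH) _ => a b; split.
  by move=> [c -> ->]; rewrite addSnnS.
by move=> ->; exists a.+1; rewrite ?addSnnS.
Qed.

Lemma has_graph_adj_shift_exp n :
  has_graph (adj (shift R) ^** n) (fun a b => a = (b + n)%N).
Proof.
have S1 := has_graph_adj (has_graph_shift_exp 1).
have E : shift R ^** 1 = shift R by exact: op_eq.
rewrite E in S1.
elim: n => [|n IH] /=.
  by apply: has_graph_ext (has_graph1 _ _) _ => a b; rewrite addn0; split.
apply: has_graph_ext (has_graph_mul S1 IH) _ => a b; split.
  by move=> [c -> ->]; rewrite addn1 addnS.
by move=> ->; exists (b + n)%N; rewrite ?addn1 ?addnS.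
Qed.

Lemma has_graph_proj0 : has_graph (proj0 R) (fun a b => a = 0%N /\ b = 0%N).
Proof.
apply: has_graph_pullback => i j; case: eqP => [->|i0]; split=> //.
- by move=> [<-].
- by move=> [_ ->].
- by move=> [].
Qed.

Lemma has_graph_unit (m n : nat) :
  has_graph (adj (shift R) ^** m ** proj0 R ** shift R ^** n)
    (fun a b => a = m /\ b = n).
Proof.
apply: has_graph_ext (has_graph_mul (has_graph_mul (has_graph_adj_shift_exp m)
  has_graph_proj0) (has_graph_shift_exp n)) _ => a b; split.
  by move=> [c [d -> [-> ->]] ->].
by move=> [-> ->]; exists 0%N => //; exists 0%N.
Qed.

Lemma has_graph_bicyclic (m n : nat) :
  has_graph (adj (shift R) ^** m ** shift R ^** n)
    (fun a b => (m <= a)%N /\ (n <= b)%N /\ (a + n = b + m)%N).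
Proof.
apply: has_graph_ext (has_graph_mul (has_graph_adj_shift_exp m)
  (has_graph_shift_exp n)) _ => a b; split.
  by move=> [c -> ->]; lia.
by move=> ab; exists (a - m)%N; lia.
Qed.

Lemma has_graph_bishift : has_graph (bishift R) (fun z w => z = w + 1).
Proof.
apply: has_graph_pullback => z w; split=> [[<-]|->]; first by rewrite subrK.
by rewrite addrK.
Qed.

Lemma has_graph_bishift_exp (e : int) :
  has_graph (unitary_exp (bishift R) e) (fun z w => z = w + e).
Proof.
case: e => n /=.
  elim: n => [|n IH] /=.
    by apply: has_graph_ext (has_graph1 _ _) _ => a b; rewrite addr0; split.
  apply: has_graph_ext (has_graph_mul has_graph_bishift IH) _ => a b; split.
    by move=> [c -> ->]; lia.
  by move=> ->; exists (b + n%:Z); lia.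
have T := has_graph_adj has_graph_bishift.
have E : Negz n = - n.+1%:Z by rewrite NegzE.
rewrite E -[X in has_graph X]/(adj (bishift R) ^** n.+1).
elim: n.+1 => [|k IH] /=.
  by apply: has_graph_ext (has_graph1 _ _) _ => a b; rewrite subr0; split.
apply: has_graph_ext (has_graph_mul T IH) _ => a b; split.
  by move=> [c ? ?]; lia.
by move=> ->; exists (b - k%:Z); lia.
Qed.

End ShiftGraphs.

(** * The semigroup T *)

Section Semigroup.
Variables (R : realType) (l : nat).
Implicit Types (m n a b : {ffun 'I_l -> nat}) (r : int) (k j : nat).

(** The graph of the i-th tensor factor of B_k (counted from 0): a matrix unit,
an element of the bicyclic monoid, or the identity. *)
Definition cell k (i : nat) (m n a b : nat) : Prop :=
  if (i.+1 < k)%N then a = m /\ b = n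
  else if i.+1 == k then (m <= a)%N /\ (n <= b)%N /\ (a + n = b + m)%N
  else a = b.

Definition twist k r : int := if k == l.+1 then r else 0.

(** Compared with the definition of B_k, the exponent of the bilateral shift is
absorbed in the passage from z to z - |a|. *)
Definition graphB k r m n (u v : idx l) : Prop :=
  (forall i : 'I_l, cell k i (m i) (n i) (u.1 i) (v.1 i)) /\
  u.2 - Defs.total u.1 = v.2 - Defs.total v.1 + twist k r.

(** A matrix unit or a bicyclic element at (m_i, n_i) changes the degree by
m_i - n_i, and an identity factor preserves it. *)
Lemma total_cell k m n a b :
  (forall i : 'I_l, cell k i (m i) (n i) (a i) (b i)) ->
  Defs.total a - Defs.total b =
  \sum_(i < l | (i.+1 <= k)%N) ((m i)%:Z - (n i)%:Z).
Proof.
move=> ab; rewrite /Defs.total -sumrB [RHS]big_mkcond; apply: eq_bigr => i _.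
have := ab i; rewrite /cell [(i.+1 <= k)%N]leq_eqVlt.
case: (ltnP i.+1 k) => _; first by rewrite orbT => -[-> ->].
by rewrite orbF; case: eqP => [_|_ ->]; lia.
Qed.

Lemma has_graphB k r m n : has_graph (opB R k r m n) (graphB k r m n).
Proof.
pose s : int := \sum_(i < l | (i.+1 <= k)%N) ((m i)%:Z - (n i)%:Z).
apply: (@has_graph_ext _ _ _ (fun u v : idx l =>
  (forall i : 'I_l, cell k i (m i) (n i) (u.1 i) (v.1 i)) /\
  u.2 = v.2 + (twist k r + s))).
  apply: (has_graph_tensor (P := fun i => cell k i (m i) (n i))
    _ (has_graph_bishift_exp R _)) => i; rewrite /cell.
  case: ifP => _; first exact: has_graph_unit.
  case: ifP => _; [exact: has_graph_bicyclic | exact: has_graph1].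
move=> [a z] [b w]; rewrite /graphB /=.
by split=> -[ab]; split=> //; move: (total_cell ab); rewrite -/s; lia.
Qed.

Lemma cellC k i (m n a b : nat) : cell k i m n a b <-> cell k i n m b a.
Proof.
by rewrite /cell; case: ifP => _; last case: ifP => _; lia.
Qed.

Lemma adj_opB k r m n : adj (opB R k r m n) = opB R k (- r) n m.
Proof.
apply: has_graph_eq (has_graph_adj (has_graphB k r m n)) _.
apply: has_graph_ext (has_graphB _ _ _ _) _ => -[a z] [b w]; rewrite /graphB /=.
by rewrite /twist; split=> -[ab e]; (split; first by move=> i; apply/cellC);
  move: e; case: ifP; lia.
Qed.


(** The condition, for k < j, that the product of B_k(r,m,n) and B_j(r',m',n')
is nonzero; for k = j <= l it selects the products that keep the right index n'. *)
Definition composable k n m' : Prop := forall i : 'I_l,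
  ((i.+1 < k)%N -> n i = m' i) /\ (i.+1 = k -> (n i <= m' i)%N).

(** Below k this is the rule for matrix units. At k, an inequality n <= m' lets
S*^m S^n S*^m' collapse to S*^(m + m' - n). Beyond k the left factor is the
identity. *)
Lemma cell_mul k j i (m n m' n' a c : nat) : (k <= j)%N ->
  ((i.+1 < k)%N -> n = m') /\ (i.+1 = k -> (n <= m')%N) ->
  (exists2 b, cell k i m n a b & cell j i m' n' b c) <->
  cell j i (if (i.+1 <= k)%N then m + (m' - n) else m')%N n' a c.
Proof.
move=> kj nm; split=> [[b]|ac].
  by rewrite /cell; do ![case: ifP => ?]; lia.
exists (if (i.+1 <= k)%N then n + (a - m) else a)%N; move: ac;
  by rewrite /cell; do ![case: ifP => ?]; lia.
Qed.

Definition splice k m n m' : {ffun 'I_l -> nat} :=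
  [ffun i : 'I_l => if (i.+1 <= k)%N then (m i + (m' i - n i))%N else m' i].

(** The coordinates of an intermediate index are chosen one by one from
[cell_mul], and its last component is then forced by the degree condition. *)
Lemma opB_mul k j r r' m n m' n' : (k <= j <= l.+1)%N -> composable k n m' ->
  opB R k r m n ** opB R j r' m' n' =
  opB R j (twist k r + r') (splice k m n m') n'.
Proof.
move=> /andP[kj jl] nm.
apply: has_graph_eq (has_graph_mul (has_graphB _ _ _ _) (has_graphB _ _ _ _)) _.
have tw : twist j (twist k r + r') = twist k r + twist j r'.
  by rewrite /twist; do 2?case: eqP => //; lia.
apply: has_graph_ext (has_graphB _ _ _ _) _ => -[a z] [c v].
rewrite /graphB tw /=; split.
  move=> [ac e].
  have /choice [b abc] : forall i : 'I_l, exists b : nat,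
      cell k i (m i) (n i) (a i) b /\ cell j i (m' i) (n' i) b (c i).
    move=> i; move: (ac i); rewrite ffunE => /(cell_mul _ _ _ _ kj (nm i)).
    by case=> b; exists b.
  exists ([ffun i => b i],
    v - Defs.total c + twist j r' + Defs.total [ffun i => b i]) => /=.
    by split; [move=> i; rewrite ffunE; case: (abc i) | lia].
  by split; [move=> i; rewrite ffunE; case: (abc i) | lia].
move=> [[b w] /= [ab e] [bc e']]; split; last lia.
by move=> i; rewrite ffunE; apply/(cell_mul _ _ _ _ kj (nm i)); exists (b i).
Qed.

Lemma opB_mul0 k j r r' m n m' n' :
  (forall a b c : {ffun 'I_l -> nat},
    (forall i : 'I_l, cell k i (m i) (n i) (a i) (b i)) ->
    (forall i : 'I_l, cell j i (m' i) (n' i) (b i) (c i)) -> False) ->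
  opB R k r m n ** opB R j r' m' n' = op0.
Proof.
move=> H.
apply: has_graph_eq (has_graph_mul (has_graphB _ _ _ _) (has_graphB _ _ _ _)) _.
apply: has_graph_ext (has_graph0 _ _) _ => u v.
by split=> // -[w [uw _] [wv _]]; exact: H uw wv.
Qed.

Lemma opB_in_opT k r m n : (1 <= k <= l.+1)%N -> opT R l (opB R k r m n).
Proof. by move=> kl; right; exists k, r, m, n. Qed.

Lemma opT_has_graph A : opT R l A -> exists P, has_graph A P.
Proof.
move=> [->|[k [r [m [n [_ ->]]]]]]; first by eexists; exact: has_graph0.
by eexists; exact: has_graphB.
Qed.

Lemma opT_adj A : opT R l A -> opT R l (adj A).
Proof.
move=> [->|[k [r [m [n [kl ->]]]]]]; last first.
  by rewrite adj_opB; exact: opB_in_opT.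
by left; apply: has_graph_eq (has_graph_adj (has_graph0 _ _)) (has_graph0 _ _).
Qed.

(** Taking adjoints exchanges the two factors, so one may assume k < j, or k = j
and n_k <= m'_k. Then the product is given by [opB_mul], unless one of the
composability conditions fails; in this case the intermediate index would have
contradictory coordinates and the product is zero. *)
Lemma opB_mul_closed k j r r' m n m' n' :
  (1 <= k <= l.+1)%N -> (1 <= j <= l.+1)%N ->
  opT R l (opB R k r m n ** opB R j r' m' n').
Proof.
pose ok k j n m' := (k < j)%N \/
  (k = j /\ forall i : 'I_l, i.+1 == k -> (n i <= m' i)%N).
wlog kj : k j r r' m n m' n' / ok k j n m' => [W|] k1 j1.
  have [h|h] := pselect (ok k j n m'); first exact: W.
  (* There is at most one i with i + 1 = k, so if the inequality fails there,
     the reverse one holds for all such i. *)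
  have h' : ok j k m' n.
    rewrite /ok; case: (ltngtP k j) => kj; [by case: h; left|by left|right].
    split=> // i ik; case: (leqP (m' i) (n i)) => // /ltnW nm.
    case: h; right; split=> // i' i'k; suff -> : i' = i by [].
    by apply: val_inj => /=; lia.
  have := opT_adj (W _ _ (- r') (- r) n' m' n m h' j1 k1).
  rewrite -!adj_opB -(adj_mul (has_graphB k r m n) (has_graphB j r' m' n')).
  by rewrite (adjK (has_graph_mul (has_graphB _ _ _ _) (has_graphB _ _ _ _))).
have kj' : (k <= j <= l.+1)%N by case: kj => [|[]]; lia.
have [c|nc] := pselect (composable k n m').
  by rewrite opB_mul //; exact: opB_in_opT.
left; apply: opB_mul0 => a b c ab bc; apply: nc => i.
case: kj => [kj|[kj nm]].
  by move: (ab i) (bc i); rewrite /cell; do ![case: ifP => ?]; lia.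
split=> [ik|/eqP]; last exact: nm.
by move: (ab i) (bc i); rewrite /cell -kj ik; lia.
Qed.

Lemma opT_mul A B : opT R l A -> opT R l B -> opT R l (A ** B).
Proof.
move=> [->|[k [r [m [n [kl ->]]]]]].
  move=> _; left; apply: op_eq => x; exact: l2_eq.
move=> [->|[j [r' [m' [n' [jl ->]]]]]]; last exact: opB_mul_closed.
left; apply: has_graph_eq
  (has_graph_mul (has_graphB _ _ _ _) (has_graph0 _ _)) _.
by apply: has_graph_ext (has_graph0 _ _) _ => u v; split=> // -[].
Qed.

(** B_k ignores the entries of m and n beyond the k-th one, and r unless
k = l+1. *)
Lemma opB_ext k r r' m n m' n' :
  (forall i : 'I_l, (i.+1 <= k)%N -> m i = m' i) ->
  (forall i : 'I_l, (i.+1 <= k)%N -> n i = n' i) ->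
  twist k r = twist k r' -> opB R k r m n = opB R k r' m' n'.
Proof.
move=> mm nn rr; apply: has_graph_eq (has_graphB k r m n) _.
apply: has_graph_ext (has_graphB _ _ _ _) _ => u v; rewrite /graphB rr.
by split=> -[uv ->]; split=> // i; move: (uv i) (mm i) (nn i); rewrite /cell;
  case: ltngtP => //= _ h me ne; move: h; rewrite me ?ne.
Qed.

Definition unit_index k : {ffun 'I_l -> nat} :=
  [ffun i : 'I_l => (i.+1 == k : nat)].

Definition zero_index : {ffun 'I_l -> nat} := [ffun=> 0%N].

(** As p = S*^0 p S^0 and S* = S*^1 S^0, the factors of Y_k are those of
B_k(1,e_k,0); conjugation by U replaces z by z - |a| in the graph. *)
Lemma opZE k : opZ R l k = opB R k 1 (unit_index k) zero_index.
Proof.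
have U1 : has_graph (unitU R l)
    (fun u v : idx l => v = (u.1, u.2 - Defs.total u.1)).
  by apply: has_graph_pullback => -[a z] v /=; split=> [[<-]|->].
have Y1 : has_graph (opY R l k) (fun u v : idx l =>
    (forall i : 'I_l, cell k i (unit_index k i) (zero_index i) (u.1 i) (v.1 i))
    /\ u.2 = v.2 + twist k 1).
  apply: (has_graph_tensor
    (P := fun i => cell k i (unit_index k i) (zero_index i))
    (Q := fun z w => z = w + twist k 1)) => [i|].
    rewrite /cell !ffunE; case: (ltngtP i.+1 k) => ik.
    - exact: has_graph_proj0.
    - exact: has_graph1.
    - have E : adj (shift R) ^** 1 = adj (shift R) by exact: op_eq.
      rewrite -E; apply: has_graph_ext (has_graph_adj_shift_exp R 1) _ => a b.
      by rewrite /=; lia.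
  rewrite /twist; case: ifP => _; first exact: has_graph_bishift.
  by apply: has_graph_ext (has_graph1 _ _) _ => z w; rewrite addr0.
apply: has_graph_eq (has_graphB _ _ _ _).
apply: has_graph_ext
  (has_graph_mul (has_graph_mul U1 Y1) (has_graph_adj U1)) _ => u v; split.
  by move=> [v' [_ -> uv'] v'E]; move: uv'; rewrite v'E.
move=> [uv e]; exists (v.1, v.2 - Defs.total v.1) => //.
by exists (u.1, u.2 - Defs.total u.1).
Qed.

Definition gens : set (op R (idx l)) :=
  [set opZ R l k | k in [set k : nat | (1 <= k <= l.+1)%N]].

Local Notation gen := (generated (@op_mul R (idx l)) (@adj R (idx l)) gens).

Lemma generated_opT A : gen A -> opT R l A.
Proof.
elim=> [_ [k kl <-]|_ [k kl <-]|B C _ IB _ IC]; last exact: opT_mul.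
  by rewrite opZE; exact: opB_in_opT.
by rewrite opZE; apply: opT_adj; exact: opB_in_opT.
Qed.

Lemma generated_adj A : gen A -> gen (adj A).
Proof.
elim=> [B XB|B XB|B C GB IB GC IC]; first exact: generated_star.
  have [P BP] := opT_has_graph (generated_opT (generated_in _ _ XB)).
  by rewrite (adjK BP); exact: generated_in.
have [P BP] := opT_has_graph (generated_opT GB).
have [Q CQ] := opT_has_graph (generated_opT GC).
by rewrite (adj_mul BP CQ); exact: generated_mul.
Qed.

Lemma generated_opZ k : (1 <= k <= l.+1)%N -> gen (opZ R l k).
Proof. by move=> kl; apply: generated_in; exists k. Qed.

(** The projection Z_k* Z_k is B_k(0,0,0). For k = l+1 the operators B_k(r,0,0)
form a copy of the group of integers generated by Z_k. *)
Lemma generated_vertex k r : (1 <= k <= l.+1)%N ->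
  gen (opB R k r zero_index zero_index).
Proof.
move=> kl; have GZ := generated_opZ kl.
have G0 : gen (opB R k 0 zero_index zero_index).
  have := generated_mul (generated_adj GZ) GZ.
  rewrite opZE adj_opB opB_mul ?leqnn //=; last by case/andP: kl.
  rewrite (opB_ext (r' := 0) (m' := zero_index) (n' := zero_index)) //.
    by move=> i ik; rewrite !ffunE ik subnn.
  by rewrite /twist; case: eqP.
case: (eqVneq k l.+1) => [kE|kl1]; last first.
  by rewrite (opB_ext (r' := 0) (m' := zero_index) (n' := zero_index)) //
    /twist (negPf kl1).
have G1 : gen (opB R k 1 zero_index zero_index).
  move: GZ; rewrite opZE.
  rewrite (opB_ext (r' := 1) (m' := zero_index) (n' := zero_index)) //.
  by move=> i _; rewrite !ffunE kE eqSS; have := ltn_ord i; case: ltngtP.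
have GD x y : gen (opB R k x zero_index zero_index) ->
    gen (opB R k y zero_index zero_index) ->
    gen (opB R k (x + y) zero_index zero_index).
  move=> Gx Gy; have := generated_mul Gx Gy.
  rewrite opB_mul ?leqnn //=; last by case/andP: kl.
  rewrite (opB_ext (r' := x + y) (m' := zero_index) (n' := zero_index)) //.
    by move=> i ik; rewrite !ffunE ik.
  by rewrite /twist kE eqxx.
have GN : gen (opB R k (- 1) zero_index zero_index).
  by rewrite -adj_opB; exact: generated_adj.
elim/int_rect: r => [//|n IH|n IH].
  by rewrite -addn1 PoszD; exact: GD.
by rewrite -addn1 PoszD opprD; exact: GD.
Qed.

(** By induction on |m|: if j is the first index with m_j > 0, then
B_k(r,m,0) = Z_j B_k(r,m - e_j,0), since the factors p of Z_j meet the vanishing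
entries of m. *)
Lemma generated_left k r m : (1 <= k <= l.+1)%N ->
  gen (opB R k r m zero_index).
Proof.
move=> kl; have [N] := ubnP (\sum_(i < l) m i)%N.
elim: N m => // N IH m; rewrite ltnS => mN.
have [/forallP m0|/forallPn /= [i1 mi1]] := boolP [forall i, m i == 0%N].
  suff -> : m = zero_index by exact: generated_vertex.
  by apply/ffunP => i; rewrite ffunE; exact/eqP.
case: (@arg_minnP _ i1 (fun i => m i != 0%N) val mi1) => i0 mi0 i0min.
have m0 (i : 'I_l) : (i < i0)%N -> m i = 0%N.
  by move=> ii0; apply/eqP; apply/negPn/negP => /i0min; rewrite leqNgt ii0.
have [ki0|i0k] := ltnP k i0.+1.
  rewrite (opB_ext (r' := r) (m' := zero_index) (n' := zero_index)) //.
    exact: generated_vertex.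
  by move=> i ik; rewrite ffunE m0 //; lia.
pose m' := [ffun i => (m i - (i == i0))%N].
have -> : opB R k r m zero_index = opZ R l i0.+1 ** opB R k r m' zero_index.
  rewrite opZE opB_mul; [|lia|]; last first.
    by move=> i; rewrite !ffunE; split=> [ii0|//]; rewrite m0 //; lia.
  apply: opB_ext => //.
    move=> i ik; rewrite !ffunE -val_eqE /= !eqSS ltnS.
    case: (ltngtP i i0) => [ii0|ii0|/val_inj ->].
    - by rewrite m0.
    - by rewrite subn0.
    - by rewrite subn0 subnKC // lt0n.
  congr (twist k _); rewrite /twist eqSS.
  by have := ltn_ord i0; case: ltngtP; rewrite ?add0r.
apply: generated_mul; first by apply: generated_opZ; have := ltn_ord i0; lia.
apply: IH; apply: leq_trans mN.
rewrite (bigD1 i0) //= [leqRHS](bigD1 i0) //= ffunE eqxx.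
rewrite (eq_bigr (fun i => m i)) => [|i /negPf ii0]; last first.
  by rewrite ffunE ii0 subn0.
by rewrite ltn_add2r subn1 ltn_predL lt0n.
Qed.

Lemma generated_opB k r m n : (1 <= k <= l.+1)%N -> gen (opB R k r m n).
Proof.
move=> kl.
have -> : opB R k r m n =
    opB R k r m zero_index ** adj (opB R k 0 n zero_index).
  rewrite adj_opB opB_mul ?leqnn //=; last by case/andP: kl.
  apply: opB_ext => // [i ik|]; first by rewrite !ffunE ik addn0.
  by rewrite oppr0 addr0 /twist; case: eqP.
apply: generated_mul; first exact: generated_left.
by apply: generated_adj; exact: generated_left.
Qed.

(** The first factor of Z_1* Z_2 is S p = 0. *)
Lemma generated_op0 : (0 < l)%N -> gen op0.
Proof.
move=> l0; have <- : adj (opZ R l 1) ** opZ R l 2 = op0.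
  rewrite !opZE adj_opB; apply: opB_mul0 => a b c ab bc.
  have := ab (Ordinal l0); have := bc (Ordinal l0).
  by rewrite /cell !ffunE /=; lia.
by apply: generated_mul; [apply: generated_adj|]; exact: generated_opZ.
Qed.

End Semigroup.

Theorem proposition3p2 (R : realType) (l : nat) (hl : (0 < l)%N) :
  [/\ inverse_semigroup (@op_mul R (idx l)) (@adj R (idx l)) (opT R l),
      forall A : op R (idx l), opT R l A -> partial_isometry A
    & opT R l = generated (@op_mul R (idx l)) (@adj R (idx l))
                  [set opZ R l k | k in [set k : nat | (1 <= k <= l.+1)%N]]].
Proof.
split.
- split=> [A B|A B C _ _ _|A TA|A B TA TB].
  + exact: opT_mul.
  + exact: op_eq.
  + have [P AP] := opT_has_graph TA; split; first exact: opT_adj.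
      by have := has_graph_regular (has_graph_adj AP); rewrite (adjK AP).
    exact: has_graph_regular AP.
  + have [P AP] := opT_has_graph TA; have [Q BQ] := opT_has_graph TB.
    exact: has_graph_inverse AP BQ.
- by move=> A /opT_has_graph [P AP]; exact: has_graph_partial_isometry AP.
- apply/seteqP; split=> [A|A]; last exact: generated_opT.
  move=> [->|[k [r [m [n [kl ->]]]]]]; first exact: generated_op0.
  exact: generated_opB.
Qed.
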